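(* Let $k\ge 2$ and let $T$ be a tree of order $n$ with distance $k$-domination number $\gamma_k=\gamma_k(T)\ge 3$. Then \[ \Pi_1(T)\ge 4^{k\gamma_k-1}(n-k\gamma_k)^2 \quad\text{and}\quad \Pi_2(T)\le 4^{k\gamma_k-1}(n-k\gamma_k)^{n-k\gamma_k}. \] Either equality holds if and only if $T\cong T_{n,k,\gamma_k}$.
   Context: For a graph $G$ with vertex degrees $d_G(u)$: $\Pi_1(G)=\prod_{u\in V(G)}d_G(u)^2$ and $\Pi_2(G)=\prod_{uv\in E(G)}d_G(u)d_G(v)=\prod_{u\in V(G)}d_G(u)^{d_G(u)}$. A set $D\subseteq V(G)$ is a distance $k$-dominating set if every vertex not in $D$ is at distance at most $k$ from some vertex of $D$; $\gamma_k(G)$ is the minimum size of such a set. For positive integers $n,k,s$ with $n\ge (k+1)s$, $T_{n,k,s}$ is the starlike tree obtained from a vertex $c$ by attaching to $c$: one pendent path containing $k$ vertices other than $c$, $s-1$ pendent paths each containing $k+1$ vertices other than $c$, and $n-(k+1)s$ pendent vertices. It has $n$ vertices, $c$ has degree $n-ks$, and there are exactly $ks-1$ vertices of degree $2$. *)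

(* Defs.v *)
From mathcomp Require Import all_boot.
Set Implicit Arguments. Unset Strict Implicit. Unset Printing Implicit Defensive.

Section Graphs.
Variable T : finType.
Implicit Types (e : rel T) (D : {set T}).

Definition simple_graph e := symmetric e /\ irreflexive e.

(* a tree: simple, connected, with exactly #|T| - 1 edges
   (each edge counted twice as an ordered pair) *)
Definition is_tree e :=
  [/\ simple_graph e, (forall x y, connect e x y) &
      #|[set p : T * T | e p.1 p.2]| = (#|T| - 1).*2].

Fixpoint within e (k : nat) (x y : T) : bool :=
  match k with
  | 0 => x == y
  | k'.+1 => (x == y) || [exists z, e x z && within e k' z y]
  end.

Definition kdom e k D :=
  [forall v, (v \in D) || [exists d in D, within e k d v]].

(* distance k-domination number: minimum size of a k-dominating set
   ([set: T] is always k-dominating) *)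
Definition gammak e k : nat :=
  #|[arg min_(D < [set: T] | kdom e k D) #|D|]|.

Definition deg e (u : T) : nat := #|[set v | e u v]|.

Definition Pi1 e : nat := \prod_(u : T) (deg e u) ^ 2.
Definition Pi2 e : nat := \prod_(u : T) (deg e u) ^ (deg e u).

End Graphs.

(* The starlike tree T_{n,k,s} on vertex set 'I_n:
   vertex 0 is the centre c; vertices 1..k form the pendent path with k
   vertices (1 adjacent to c); for 1 <= j <= s-1, vertices
   j(k+1), ..., j(k+1)+k form a pendent path with k+1 vertices (j(k+1)
   adjacent to c); vertices (k+1)s, ..., n-1 are pendent vertices at c.
   tparent i is the neighbour of i (> 0) closer to c. *)
Definition tparent (k s i : nat) : nat :=
  if i < (k.+1) * s then (if i %% k.+1 == 0 then 0 else i.-1) else 0.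

Definition Tnks_edge (n k s : nat) : rel 'I_n :=
  fun i j => ((0 < i) && (val j == tparent k s i))
          || ((0 < j) && (val i == tparent k s j)).

Definition isomorphic (T : finType) (e : rel T) (m : nat) (e' : rel 'I_m) :=
  exists f : T -> 'I_m, bijective f /\ forall x y, e x y = e' (f x) (f y).

Arguments Tnks_edge : clear implicits.
Arguments isomorphic : clear implicits.

(* Main.v *)
(* Let m be the number of non-leaves of the tree. The degrees of the non-leaves
   are at least 2 and sum to n + m - 2; replacing two degrees a, b > 2 by 2 and
   a + b - 2 decreases the product of the degrees and increases Pi2, so both are
   extremal when at most one degree exceeds 2, and the extremal values
   2^(m-1) (n-m) and 4^(m-1) (n-m)^(n-m) are strictly monotone in m.

   The bound m >= k gamma_k is Meir and Moon's argument: root the tree at an end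
   of a diametral path and split the non-leaves by their depth mod k; because the
   path is diametral, each of the k classes is k-dominating.

   In the equality case the tree is a spider. Write the length of each leg as
   q k + r + 1 with r < k. Dominating the legs by points at distance k apart gives
   sum q = gamma_k - 1 and sum r = k - 1. A leg with q >= 2, or the absence of a
   leg with q = 0 and r = k - 1, would allow a dominating set of size
   gamma_k - 1. *)

Require Import Defs.
From mathcomp Require Import all_boot.
From mathcomp Require Import zify.
Set Implicit Arguments. Unset Strict Implicit. Unset Printing Implicit Defensive.

(** * Inequalities for the self-power [d ^ d] *)

(* Bernoulli: (1 - 1/x)^t >= 1 - t/x. *)
Lemma bernoulli_sub x t : x ^ t.+1 <= x * (x - 1) ^ t + t * x ^ t.
Proof.
case: x => [|x]; first by rewrite exp0n //.
rewrite subn1 /=.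
elim: t => [|t IH]; first by rewrite !expn0 !expn1; lia.
rewrite expnS; have := leq_mul (leqnn x.+1) IH.
have : x ^ t <= x.+1 ^ t by case: t {IH} => [//|t]; rewrite leq_exp2r.
rewrite !expnS; set A := x ^ t; set B := x.+1 ^ t; nia.
Qed.

(** With [s = t + 1], the identity [t (t + 2) = s^2 - 1] turns the right side into
    [(s^2 - 1)^t (s + 1)^2], and Bernoulli at [x = s^2] bounds the first factor from below. *)
Lemma selfpow_logconvex t : (t.+1 ^ t.+1) ^ 2 < t ^ t * t.+2 ^ t.+2.
Proof.
set s := t.+1.
have E : t * t.+2 = s ^ 2 - 1 by rewrite /s; nia.
have -> : t ^ t * t.+2 ^ t.+2 = (s ^ 2 - 1) ^ t * s.+1 ^ 2.
  by rewrite -E expnMn -addn2 expnD mulnA addn2.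
have := bernoulli_sub (s ^ 2) t.
rewrite -!expnM.
have -> : s ^ (s * 2) = s ^ (2 * t) * s ^ 2 by rewrite -expnD; congr (_ ^ _); rewrite /s; lia.
have -> : s ^ (2 * t.+1) = s ^ (2 * t) * s ^ 2 by rewrite -expnD; congr (_ ^ _); lia.
have : 0 < s ^ (2 * t) by rewrite expn_gt0.
set P := s ^ _; set Q := (_ - 1) ^ t => P0 H.
have : t = s - 1 by rewrite /s; lia.
have : 0 < s by [].
clearbody P Q s.
move=> s0 ts; subst t.
have : P * s ^ 2 < Q * s.+1 ^ 2; last by [].
have H1 : P * (s ^ 2 - (s - 1)) <= s ^ 2 * Q by nia.
have H2 : P * (s ^ 2 - (s - 1)) * s.+1 ^ 2 <= s ^ 2 * Q * s.+1 ^ 2 by rewrite leq_mul2r H1 orbT.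
(* Here [(s^2 - s + 1) (s + 1)^2 = (s^3 + 1) (s + 1)], which exceeds [s^4]. *)
have H3 : (s ^ 2) * (s ^ 2) < (s ^ 2 - (s - 1)) * s.+1 ^ 2 by nia.
have : s ^ 2 * (P * s ^ 2) < s ^ 2 * (Q * s.+1 ^ 2) by nia.
by rewrite ltn_pmul2l // expn_gt0 s0.
Qed.

(** The ratio of consecutive self-powers increases, by chaining log-convexity from [b] up to [t]. *)
Lemma selfpow_ratio b t : b < t ->
  b.+1 ^ b.+1 * t ^ t < b ^ b * t.+1 ^ t.+1.
Proof.
elim: t => // t IH; rewrite ltnS leq_eqVlt => /orP[/eqP<-|/IH {}IH].
  by rewrite mulnn; apply: selfpow_logconvex.
have := selfpow_logconvex t; rewrite -mulnn.
have : 0 < t ^ t by case: (t) => // t'; rewrite expn_gt0.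
have : 0 < t.+1 ^ t.+1 by rewrite expn_gt0.
move: (t ^ t) (t.+1 ^ _) (t.+2 ^ _) (b ^ b) (b.+1 ^ _) IH => A B C D E IH B0 A0 H.
have H1 : E * A * (B * B) < D * B * (A * C).
  by apply: ltn_mul.
have : (A * B) * (E * B) < (A * B) * (D * C) by nia.
by rewrite ltn_pmul2l // muln_gt0 A0.
Qed.

(** Induction on [b] from the equality at [b = 2]: each increment multiplies both sides by a ratio
    of consecutive self-powers, and the ratio on the right is taken at the larger argument
    [a + b - 2]. *)
Lemma selfpow_merge a b : 2 < a -> 2 < b ->
  a ^ a * b ^ b < 2 ^ 2 * (a + b - 2) ^ (a + b - 2).
Proof.
move=> a2; elim: b => // b IH; rewrite ltnS => b2.
have : a ^ a * b ^ b <= 2 ^ 2 * (a + b - 2) ^ (a + b - 2).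
  by move: b2; rewrite leq_eqVlt => /orP[/eqP<-|/IH/ltnW//]; rewrite addnK mulnC.
have -> : a + b.+1 - 2 = (a + b - 2).+1 by lia.
have : b < a + b - 2 by lia.
move: (a + b - 2) => t /selfpow_ratio H1 H2.
have t0 : 0 < t ^ t by case: (t) => // t'; rewrite expn_gt0.
have a0 : 0 < a ^ a by rewrite expn_gt0; lia.
rewrite -(ltn_pmul2r t0) -mulnA; move: H1 H2 t0 a0.
move: (t ^ t) (t.+1 ^ _) (a ^ a) (b ^ b) (b.+1 ^ _) => A B C D E H1 H2 A0 C0.
have H3 : C * (E * A) < C * (D * B) by rewrite ltn_pmul2l.
by apply: leq_trans H3 _; rewrite mulnA (mulnAC _ B) leq_mul2r H2 orbT.
Qed.

Lemma selfpow_pred a : 2 < a -> 2 ^ 2 * a.-1 ^ a.-1 < a ^ a.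
Proof.
case: a => // a; rewrite ltnS leq_eqVlt => /orP[/eqP<-//|a2] /=.
have : a ^ a < a.+1 ^ a by rewrite ltn_exp2r //; lia.
by rewrite [a.+1 ^ a.+1]expnS; move: (a ^ a) (_ ^ a) => A B; nia.
Qed.

(** * Extremal products over degree sequences with entries at least 2 *)

Section Merge.
(* [lt] is [ltn] for [Pi1] and [gtn] for [Pi2]. *)
Variables (lt : rel nat) (g : nat -> nat).
Hypothesis lt_trans : transitive lt.
Hypothesis lt_mul : forall c a b, 0 < c -> lt a b -> lt (c * a) (c * b).
Hypothesis g_gt0 : forall a, 0 < a -> 0 < g a.
Hypothesis g_merge : forall a b, 2 < a -> 2 < b -> lt (g 2 * g (a + b - 2)) (g a * g b).
Hypothesis g_pred : forall a, 2 < a -> lt (g a) (g 2 * g a.-1).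

Lemma sumn_ge2 s : all (leq 2) s -> 2 * size s + (has (predC1 2) s) <= sumn s.
Proof.
elim: s => //= a s IH /andP[a2 /IH]; case: eqVneq => [->|an] /=; lia.
Qed.

Lemma sumn_eq2 s : ~~ has (predC1 2) s -> sumn s = 2 * size s.
Proof. by elim: s => //= a s IH; rewrite negb_or negbK => /andP[/eqP-> /IH->]; lia. Qed.

(** The bound is the product for the sequence of the same length and sum in which all entries but
    one are 2. The conditional form yields the inequality and its equality case together, for both
    orders [lt]. *)
Lemma prod_merge s : all (leq 2) s -> 0 < size s ->
  let bound := g 2 ^ (size s).-1 * g (sumn s - 2 * (size s).-1) in
  if count (predC1 2) s <= 1 then \prod_(a <- s) g a = bound
  else lt bound (\prod_(a <- s) g a).
Proof.
elim: s => // a u IH; case: (posnP (size u)) => [/size0nil->|u0].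
  by rewrite big_seq1 /= expn0 mul1n !addn0 muln0 subn0 => *; case: (_ == _).
rewrite [all _ _]/= => /andP[a2 u2] _; have {IH} := IH u2 u0.
have := sumn_ge2 u2; have := @sumn_eq2 u; rewrite big_cons has_count /= => eq2 ge2.
have -> : size u = (size u).-1.+1 by lia.
(* [S] is the free entry of the extremal sequence for the tail; if neither [a] nor [S] is 2, the two
   are merged into [a + S - 2]. *)
set S := sumn u - _; set B := _ ^ _ * _; set P := \prod_(_ <- _) _.
rewrite expnS -mulnA.
have -> : a + sumn u - 2 * (size u).-1.+1 = a + S - 2 by rewrite /S; lia.
have S2 : 2 <= S by rewrite /S; lia.
case: (eqVneq a 2) => [->|an] /=.
  rewrite (_ : 2 + S - 2 = S); last lia.
  rewrite add0n; case: ifP => _; first by move->.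
  by apply: lt_mul; apply: g_gt0.
case: (posnP (count (predC1 2) u)) => [c0|c0].
  rewrite c0 /= => ->; have E : S = 2 by rewrite /S eq2 ?has_count ?c0 //; lia.
  by rewrite /B E addnK /= mulnA mulnC [g a * _]mulnC.
have -> : (1 + count (predC1 2) u <= 1) = false by rewrite add1n ltnS leqNgt c0.
have S3 : 2 < S by move: ge2; rewrite /S c0; lia.
have H : lt (g 2 * (g 2 ^ (size u).-1 * g (a + S - 2))) (g a * B).
  rewrite /B; set G := _ ^ _; rewrite mulnCA [g a * _]mulnCA; apply: lt_mul.
    by rewrite expn_gt0 g_gt0.
  by apply: g_merge => //; lia.
case: ifP => _; first by move->.
by move=> /(@lt_mul (g a)) H2; apply: lt_trans H (H2 _); apply: g_gt0; lia.
Qed.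

(** One more inner vertex adds a factor [g 2] and lowers the free degree by one, which is [g_pred].
    The margin [b + 2 <= n] keeps that degree above 2 before each decrease. *)
Lemma bound_mono n a b : 0 < a -> a < b -> b + 2 <= n ->
  lt (g 2 ^ a.-1 * g (n - a)) (g 2 ^ b.-1 * g (n - b)).
Proof.
move=> a0 ab; elim: b ab => // b IH ab bn.
have H : lt (g 2 ^ b.-1 * g (n - b)) (g 2 ^ b * g (n - b.+1)).
  have -> : g 2 ^ b = g 2 ^ b.-1 * g 2 by rewrite -expnSr prednK //; lia.
  rewrite -mulnA; apply: lt_mul; first by rewrite expn_gt0 g_gt0.
  by rewrite subnS; apply: g_pred; lia.
move: ab; rewrite ltnS leq_eqVlt => /orP[/eqP->//|ab].
by apply: lt_trans (IH ab _) H; lia.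
Qed.

End Merge.

(** * Balls and dominating sets in a graph *)

Section Graph.
Variables (T : finType) (e : rel T).
Hypothesis e_sym : symmetric e.

Lemma within_mono a b x y : a <= b -> within e a x y -> within e b x y.
Proof.
elim: a b x => [|a IH] [|b] x //=; first by move=> _ ->.
rewrite ltnS => ab /orP[->//|/existsP[z /andP[xz zy]]].
by apply/orP; right; apply/existsP; exists z; rewrite xz (IH b).
Qed.

Lemma within_refl a x : within e a x x.
Proof. by case: a => [|a] /=; rewrite eqxx. Qed.

Lemma within_edge x y : e x y -> within e 1 x y.
Proof. by move=> xy /=; apply/orP; right; apply/existsP; exists y; rewrite xy eqxx. Qed.

Lemma within_trans a b x y z :
  within e a x y -> within e b y z -> within e (a + b) x z.
Proof.
elim: a x => [|a IH] x; first by move/eqP->.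
case/orP=> [/eqP-> yz|/existsP[t /andP[xt ty]] yz].
  by apply: within_mono yz; lia.
by apply/orP; right; apply/existsP; exists t; rewrite xt; exact: IH.
Qed.

Lemma within_sym a x y : within e a x y -> within e a y x.
Proof.
elim: a x => [|a IH] x /=; first by rewrite eq_sym.
case/orP=> [/eqP->|/existsP[z /andP[xz /IH zy]]]; first by rewrite eqxx.
suff : within e (a + 1) y x by rewrite addn1.
by apply: within_trans zy (within_edge _); rewrite e_sym.
Qed.

Lemma within_lipschitz (f : T -> nat) a x y :
    (forall u v, e u v -> f v <= (f u).+1) ->
  within e a x y -> f y <= f x + a.
Proof.
move=> fL; elim: a x => [|a IH] x /=; first by move/eqP->; lia.
case/orP=> [/eqP->|/existsP[z /andP[xz /IH zy]]]; first by lia.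
by have := fL _ _ xz; lia.
Qed.

Lemma gammak_le k (D : {set T}) : kdom e k D -> gammak e k <= #|D|.
Proof.
move=> kD; rewrite /gammak; case: arg_minnP => [|E _]; last exact.
by apply/forallP => v; rewrite inE.
Qed.

Lemma kdomP k (D : {set T}) :
  (forall v, exists2 d, d \in D & within e k d v) -> kdom e k D.
Proof.
move=> H; apply/forallP => v; have [d dD dv] := H v; apply/orP; right.
by apply/existsP; exists d; rewrite dD.
Qed.

(** * Distances and parents in a connected graph *)

Hypothesis e_conn : forall x y, connect e x y.

Lemma within_exists x y : exists a, within e a x y.
Proof.
case/connectP: (e_conn x y) => p xp yp; exists (size p).
elim: p x xp yp => [|z p IH] x /= => [_ ->//|/andP[xz zp] yz].
by apply/orP; right; apply/existsP; exists z; rewrite xz IH.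
Qed.

Definition dist x y := ex_minn (within_exists x y).

Lemma dist_le a x y : (dist x y <= a) = within e a x y.
Proof.
rewrite /dist; case: ex_minnP => d dxy dmin; apply/idP/idP; last exact: dmin.
by move=> da; apply: within_mono dxy.
Qed.

Lemma within_dist x y : within e (dist x y) x y.
Proof. by rewrite -dist_le. Qed.

Lemma dist_eq0 x y : (dist x y == 0) = (x == y).
Proof. by rewrite -leqn0 dist_le. Qed.

Lemma distxx x : dist x x = 0.
Proof. by apply/eqP; rewrite dist_eq0. Qed.

(** At [r] no neighbour qualifies, and the default makes [r] its own parent, so depth formulas with
    truncated subtraction hold at every vertex. *)
Definition parent r x := odflt x [pick z | e x z && ((dist r z).+1 == dist r x)].

Lemma parentP r x : x != r ->
  e x (parent r x) /\ (dist r (parent r x)).+1 = dist r x.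
Proof.
move=> xr; rewrite /parent; case: pickP => [z /andP[xz /eqP]//|none].
have := within_sym (within_dist r x).
case E: (dist r x) => [|d] /=.
  by move: E => /eqP; rewrite dist_eq0 eq_sym (negPf xr).
rewrite (negPf xr) => /existsP[z /andP[xz /within_sym]].
rewrite -dist_le => zd; have := none z; rewrite xz E /= eqSS.
have : dist r x <= (dist r z) + 1.
  by rewrite dist_le; apply: within_trans (within_dist r z) (within_edge _); rewrite e_sym.
by rewrite E; lia.
Qed.

Lemma parent_root r : parent r r = r.
Proof. by rewrite /parent; case: pickP => //= z; rewrite distxx andbF. Qed.

Lemma dist_parent r x : dist r (parent r x) = (dist r x).-1.
Proof.
have [->|/parentP[_ <-]//] := eqVneq x r.
by rewrite parent_root distxx.
Qed.

Lemma dist_iter_parent r x i : dist r (iter i (parent r) x) = dist r x - i.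
Proof. by elim: i => [|i IH] /=; rewrite ?subn0 // dist_parent IH subnS. Qed.

Lemma within_iter_parent r x i : within e i (iter i (parent r) x) x.
Proof.
elim: i => [|i IH]; first exact: within_refl.
rewrite iterS -add1n; have [E|/parentP[xp _]] := eqVneq (iter i (parent r) x) r.
  by rewrite E parent_root -{1}E; apply: within_mono IH; lia.
by apply: within_trans IH; apply: within_edge; rewrite e_sym.
Qed.

(** * Rooted trees: edges, ancestors and diametral paths *)

Hypothesis e_card : #|[set p : T * T | e p.1 p.2]| = (#|T| - 1).*2.

(** The pairs child-parent and parent-child are disjoint families of [#|T| - 1] directed edges each,
    so by the edge count they exhaust the edges. Acyclicity enters the proof here. *)
Lemma edge_parent r x y : e x y ->
  (x != r /\ parent r x = y) \/ (y != r /\ parent r y = x).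
Proof.
move=> xy.
pose A := [set (z, parent r z) | z in [set~ r]].
pose B := [set (parent r z, z) | z in [set~ r]].
have cA : #|A| = #|T| - 1.
  by rewrite card_imset ?cardsC1 ?subn1 // => u v [].
have cB : #|B| = #|T| - 1.
  by rewrite card_imset ?cardsC1 ?subn1 // => u v [].
have AB0 : A :&: B = set0.
  apply/setP => p; rewrite !inE; apply/negP => /andP[].
  case/imsetP => u; rewrite !inE => ur -> /imsetP[v]; rewrite !inE => vr [uv vu].
  have [_ hu] := parentP ur; have [_ hv] := parentP vr.
  by rewrite -uv in hv; rewrite vu in hu; lia.
have ABE : A :|: B \subset [set p : T * T | e p.1 p.2].
  apply/subsetP => p; rewrite !inE => /orP[] /imsetP[u]; rewrite !inE => ur -> /=.
    by have [] := parentP ur.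
  by rewrite e_sym; have [] := parentP ur.
have : (x, y) \in A :|: B.
  suff -> : A :|: B = [set p : T * T | e p.1 p.2] by rewrite inE.
  by apply/eqP; rewrite eqEcard ABE cardsU AB0 cards0 cA cB e_card; lia.
rewrite !inE => /orP[] /imsetP[u]; rewrite !inE => ur [-> ->]; first by left.
by right.
Qed.

Lemma edgeE r x y :
  e x y = ((x != r) && (parent r x == y)) || ((y != r) && (parent r y == x)).
Proof.
apply/idP/orP => [/(edge_parent r)[][-> /eqP ->]|]; first by left.
  by right.
by case=> /andP[ur /eqP <-]; [|rewrite e_sym]; have [] := parentP ur.
Qed.

Lemma deg_ge2 x u v : u != v -> e x u -> e x v -> 1 < deg e x.
Proof.
move=> uv xu xv; rewrite /deg.
have <- : #|[set u; v]| = 2 by rewrite cards2 uv.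
by apply: subset_leq_card; apply/subsetP => z; rewrite !inE => /orP[]/eqP->.
Qed.

Lemma parent_neq r x : x != r -> parent r x != r -> parent r (parent r x) != x.
Proof.
move=> xr pr; apply/eqP => E; have [_ h1] := parentP xr; have [_] := parentP pr.
by rewrite E; lia.
Qed.

Lemma parent_deg r x : x != r -> parent r x != r -> 1 < deg e (parent r x).
Proof.
move=> xr pr; apply: (@deg_ge2 _ x (parent r (parent r x))).
- by rewrite eq_sym parent_neq.
- by rewrite e_sym; have [] := parentP xr.
- by have [] := parentP pr.
Qed.

(** The index [i] is a depth counted from [r], not a number of steps up from [x]; beyond the depth
    of [x] truncation returns [x] itself. *)
Definition ancestor r i x := iter (dist r x - i) (parent r) x.

Lemma ancestor_dist r i x : i <= dist r x -> dist r (ancestor r i x) = i.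
Proof. by move=> ih; rewrite dist_iter_parent; lia. Qed.

Lemma ancestor_parent r i x : i < dist r x ->
  ancestor r i (parent r x) = ancestor r i x.
Proof. by move=> ih; rewrite /ancestor dist_parent -iterSr -subSn ?prednK //; lia. Qed.

Lemma ancestor_ancestor r i j x : i <= j -> j <= dist r x ->
  ancestor r i (ancestor r j x) = ancestor r i x.
Proof.
by move=> ij jh; rewrite {1}/ancestor ancestor_dist // -iterD addnC addnBA // subnK.
Qed.

Lemma within_ancestor r i x : within e (dist r x - i) (ancestor r i x) x.
Proof. exact: within_iter_parent. Qed.

Lemma ancestor0 r x : ancestor r 0 x = r.
Proof.
by apply/eqP; rewrite eq_sym -dist_eq0 ancestor_dist.
Qed.

(* The distance to [v] is computed explicitly from the branching level [i]; a
   1-Lipschitz function is enough to bound it from below. *)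
Lemma dist_branch r i v w : i < dist r v -> i < dist r w ->
    ancestor r i.+1 v != ancestor r i.+1 w ->
  (dist r v - i) + (dist r w - i) <= dist v w.
Proof.
move=> iv iw vw; set d := dist r v; set a := ancestor r i.+1 v.
(* [below] is the branch rooted at [a]. Inside it [f] falls with depth, outside it rises with depth,
   and across the edge above [a] the values are [d - i - 1] and [d - i]. *)
pose below x := (i < dist r x) && (ancestor r i.+1 x == a).
pose f x := if below x then d - dist r x else (d - i) + (dist r x - i).
have fp x : x != r -> f (parent r x) <= (f x).+1 /\ f x <= (f (parent r x)).+1.
  move=> xr; have [_ hx] := parentP xr; rewrite /f.
  have [xi|xi] := ltnP i.+1 (dist r x).
    have -> : below (parent r x) = below x by rewrite /below ancestor_parent //; lia.
    by case: ifP; lia.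
  have -> : below (parent r x) = false by rewrite /below; lia.
  case: ifP => [/andP[]|]; lia.
have fL x y : e x y -> f y <= (f x).+1.
  by case/(edge_parent r) => [][/fp[h1 h2] E]; rewrite E in h1 h2.
have := within_lipschitz fL (within_dist v w).
have -> : f v = 0 by rewrite /f /below iv eqxx /= subnn.
have -> : f w = d - i + (dist r w - i).
  by rewrite /f /below iw eq_sym (negPf vw).
by [].
Qed.

(** Let [i] be the depth at which the paths to [v] and [w] separate. Since [v] and [w] are no
    farther apart than [r] and [w], the branch of [v] has length at most [i]; going up [j - i] steps
    and down that branch costs at most [j]. *)
Lemma diametral_within r w j v :
    (forall x y, dist x y <= dist r w) -> dist r v <= j -> j <= dist r w ->
  within e j (ancestor r j w) v.
Proof.
move=> diam vj jw.
pose P i := (i <= dist r v) && (ancestor r i v == ancestor r i w).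
have exP : exists i, P i by exists 0; rewrite /P !ancestor0 eqxx.
have ubP i : P i -> i <= dist r v by case/andP.
case: (ex_maxnP exP ubP) => i /andP[iv /eqP E] imax.
have key : dist r v - i <= i.
  have [|iv'] := leqP (dist r v) i; first by lia.
  suff : (dist r v - i) + (dist r w - i) <= dist v w by have := diam v w; lia.
  apply: dist_branch => //; first by lia.
  by apply/negP => E'; have := imax i.+1; rewrite /P iv' E' ltnn => /(_ isT).
apply: (@within_mono ((j - i) + (dist r v - i))); first lia.
apply: (@within_trans _ _ _ (ancestor r i v)); last exact: within_ancestor.
apply: within_sym; rewrite E -(@ancestor_ancestor r i j w) //; last by lia.
have := @within_ancestor r i (ancestor r j w); by rewrite ancestor_dist.
Qed.

(** * The Meir-Moon bound: at least [k * gammak e k] inner vertices *)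

Definition inner := [set x | 1 < deg e x].

Lemma card_mod (k : nat) (A : {set T}) (f : T -> nat) : 0 < k ->
  \sum_(j < k) #|[set x in A | f x %% k == j]| = #|A|.
Proof.
move=> k0; rewrite -sum1_card.
rewrite (partition_big (fun x => Ordinal (ltn_pmod (f x) k0)) xpredT) //=.
apply: eq_bigr => j _; rewrite -sum1_card; apply: eq_bigl => x.
by rewrite inE.
Qed.

Lemma gammak_inner k : 0 < k -> 1 < gammak e k -> k * gammak e k <= #|inner|.
Proof.
move=> k0 g1.
have /card_gt0P[r0 _] : 0 < #|T|.
  have : gammak e k <= #|[set: T]|; last by rewrite cardsT; lia.
  by apply: gammak_le; apply/forallP => v; rewrite inE.
have [[r w] /= diam] : exists p : T * T, forall x y, dist x y <= dist p.1 p.2.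
  exists [arg max_(p > (r0, r0)) dist p.1 p.2]; case: arg_maxnP => //= p _ H x y.
  exact: (H (x, y)).
(* Otherwise [r] alone would dominate. This makes the ancestors of [w] at depths 1 to [k] proper,
   hence inner. *)
have kw : k < dist r w.
  rewrite ltnNge; apply/negP => wk; suff : gammak e k <= #|[set r]| by rewrite cards1; lia.
  apply/gammak_le/kdomP => v; exists r; first by rewrite inE.
  by rewrite -dist_le; apply: leq_trans (diam _ _) wk.
(* Depths are shifted by one so that class [j] starts at the positive depth [j + 1]; an ancestor at
   a positive depth has both a parent and a child when it is proper. *)
rewrite -(card_mod _ (fun x => (dist r x).-1) k0).
rewrite -[k in k * _]card_ord -sum_nat_const; apply: leq_sum => j _.
apply/gammak_le/kdomP => v; have jk := ltn_ord j.
have inn i x : 0 < i -> i < dist r x -> ancestor r i x \in inner.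
  move=> i0 ix; rewrite inE.
  have E : ancestor r i x = parent r (ancestor r i.+1 x).
    by rewrite /ancestor -iterS -subSn // subSS.
  have D1 : dist r (ancestor r i.+1 x) = i.+1 by apply: ancestor_dist.
  have D0 : dist r (ancestor r i x) = i by apply: ancestor_dist; lia.
  rewrite E; apply: parent_deg; first by rewrite eq_sym -dist_eq0 D1.
  by rewrite -E eq_sym -dist_eq0 D0; lia.
have [vj|vj] := leqP (dist r v) j.+1.
  exists (ancestor r j.+1 w).
    by rewrite inE inn ?ancestor_dist ?modn_small //; lia.
  by apply: (@within_mono j.+1) => //; apply: diametral_within => //; lia.
(* [i] is the largest depth below [h] congruent to [j + 1] modulo [k]. *)
pose h := dist r v; pose i := (h - j.+2) %/ k * k + j.+1.
have [i1 i2 i3] : [/\ j < i, i < h & h - i <= k].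
  have := ltn_pmod (h - j.+2) k0; have := divn_eq (h - j.+2) k; rewrite /i.
  by move: (_ %/ _ * _) (_ %% _) vj => q m; rewrite -/h => *; split; lia.
exists (ancestor r i v).
  rewrite inE inn ?ancestor_dist //; try lia.
  by rewrite /i addnS /= modnMDl modn_small.
by apply: within_mono (within_ancestor r i v).
Qed.

(** * Degree sums and degree products of a tree *)

Lemma deg_gt0 x : 1 < #|T| -> 0 < deg e x.
Proof.
move=> T1; have /card_gt0P[r] : 0 < #|[set~ x]| by rewrite cardsC1; lia.
rewrite !inE eq_sym => xr; apply/card_gt0P; exists (parent r x); rewrite inE.
by have [] := parentP xr.
Qed.

Lemma sum_deg : \sum_x deg e x = (#|T| - 1).*2.
Proof.
rewrite -e_card -sum1_card (eq_bigl (fun p => xpredT p.1 && e p.1 p.2)); last first.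
  by move=> p; rewrite inE.
rewrite -(pair_big_dep xpredT e (fun _ _ => 1)) /=; apply: eq_bigr => x _.
by rewrite /deg -sum1_card; apply: eq_bigl => y; rewrite inE.
Qed.

(** Leaves contribute [g 1 = 1], and the inner degrees sum to [#|T| + #|inner| - 2], so the free
    degree in [prod_merge] is [#|T| - #|inner|]. [bound_mono] then passes from [#|inner|] to [M]. *)
Lemma prod_deg_extremal (lt : rel nat) (g : nat -> nat) M :
    transitive lt ->
    (forall c a b, 0 < c -> lt a b -> lt (c * a) (c * b)) ->
    (forall a, 0 < a -> 0 < g a) -> g 1 = 1 ->
    (forall a b, 2 < a -> 2 < b -> lt (g 2 * g (a + b - 2)) (g a * g b)) ->
    (forall a, 2 < a -> lt (g a) (g 2 * g a.-1)) ->
    1 < #|T| -> 0 < M -> M <= #|inner| ->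
  let bound := g 2 ^ M.-1 * g (#|T| - M) in
  if (#|inner| <= M) && (#|[set u | 2 < deg e u]| <= 1)
  then \prod_u g (deg e u) = bound
  else lt bound (\prod_u g (deg e u)).
Proof.
move=> ltT ltM g0 g1 gm gp T1 M0 MI bound.
pose s := [seq deg e u | u <- enum inner].
have s2 : all (leq 2) s.
  by apply/allP => d /mapP[u]; rewrite mem_enum inE => du ->.
have ss : size s = #|inner| by rewrite size_map -cardE.
have d1 u : u \notin inner -> deg e u = 1.
  by rewrite inE; have := deg_gt0 u T1; lia.
have sumE : sumn s + (#|T| - #|inner|) = (#|T| - 1).*2.
  rewrite -sum_deg (bigID (mem inner)) /= sumnE big_map big_enum; congr (_ + _).
  have -> : #|T| - #|inner| = #|~: inner| by rewrite -(cardsC inner) addKn.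
  rewrite -sum1_card; apply: eq_big => u; first by rewrite in_setC.
  by rewrite in_setC => /d1.
have prodE : \prod_u g (deg e u) = \prod_(a <- s) g a.
  rewrite (bigID (mem inner)) /= [X in _ * X]big1 ?muln1 => [|u /d1->//].
  by rewrite big_map big_enum.
have countE : count (predC1 2) s = #|[set u | 2 < deg e u]|.
  rewrite count_map cardE -size_filter; apply: perm_size.
  apply: uniq_perm => [||u]; rewrite ?enum_uniq ?(filter_uniq _ (enum_uniq _)) //.
  by rewrite mem_filter !mem_enum !inE /=; lia.
have IT : #|inner| <= #|T| by rewrite max_card.
have ge2 := sumn_ge2 s2; rewrite ss in ge2.
have := prod_merge ltT ltM g0 gm s2; rewrite ss -prodE countE => /(_ ltac:(lia)) /=.
have -> : sumn s - 2 * #|inner|.-1 = #|T| - #|inner| by lia.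
have [IM|IM] := leqP #|inner| M; first by have -> : #|inner| = M by lia.
have H : lt bound (g 2 ^ #|inner|.-1 * g (#|T| - #|inner|)).
  by apply: (bound_mono ltT ltM g0 gp) => //; lia.
by rewrite /=; case: ifP => _; [move=> -> | apply: ltT H].
Qed.

Lemma dist_edge x y : e x y = (dist x y == 1).
Proof.
apply/idP/eqP => [xy|xy].
  have := xy; rewrite (edgeE x) eqxx /= => /andP[yx /eqP yp].
  by have [_] := parentP yx; rewrite yp distxx.
have yx : y != x by rewrite eq_sym -dist_eq0 xy.
have [] := parentP yx; rewrite xy => yp [] /eqP.
by rewrite dist_eq0 => /eqP E; rewrite -E in yp; rewrite e_sym.
Qed.

(** * Spiders: legs, domination along legs, and the equality case *)

Section Spider.
Variable c : T.
Hypothesis spider : forall x, x != c -> deg e x <= 2.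

(** Otherwise the common parent, not being [c], would have three neighbours: [x], [y] and its own
    parent. *)
Lemma spider_parent_inj x y : x != c -> y != c -> parent c x != c ->
  parent c x = parent c y -> x = y.
Proof.
move=> xc yc pc E; apply/eqP; apply: contraT => xy.
set z := parent c x in pc E *.
have [zw _] := parentP pc; have := spider pc; rewrite leqNgt => /negP[].
have xw : parent c z != x by apply: parent_neq.
have yw : parent c z != y by rewrite E; apply: parent_neq; rewrite -?E.
have -> : 3 = #|parent c z |: [set x; y]| by rewrite cardsU1 !inE negb_or xw yw cards2 xy.
apply: subset_leq_card; apply/subsetP => t; rewrite !inE.
case/or3P=> /eqP->; rewrite // e_sym.
  by have [] := parentP xc.
by rewrite E; have [] := parentP yc.
Qed.

(** A leg is named by its vertex adjacent to [c]. The centre is its own [top], which lies outside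
    [legs]. *)
Definition top x := ancestor c 1 x.
Definition legs := [set y | dist c y == 1].
Definition leg y := [set x | top x == y].
Definition leglen y := #|leg y|.

Lemma top_center : top c = c.
Proof. by rewrite /top /ancestor distxx. Qed.

Lemma dist_gt0 x : (0 < dist c x) = (x != c).
Proof. by rewrite lt0n dist_eq0 eq_sym. Qed.

Lemma top_legs x : x != c -> top x \in legs.
Proof. by rewrite inE -dist_gt0 => xc; rewrite ancestor_dist. Qed.

Lemma top_legsE x : (top x \in legs) = (x != c).
Proof.
apply/idP/idP; last exact: top_legs.
by apply: contraTneq => ->; rewrite top_center inE distxx.
Qed.

Lemma top_dist_inj x y : top x = top y -> dist c x = dist c y -> x = y.
Proof.
move En : (dist c x) => n; elim: n => [|n IH] in x y En *.
  move=> _ /esym/eqP; move/eqP: En; rewrite !dist_eq0.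
  by move=> /eqP<- /eqP<-.
move=> txy yn; have xc : x != c by rewrite -dist_gt0 En.
have yc : y != c by rewrite -dist_gt0 -yn.
case: n IH => [|n] IH in En yn *.
  by move: txy; rewrite /top /ancestor En -yn.
have E : parent c x = parent c y.
  apply: IH; rewrite ?dist_parent ?En -?yn //.
  by rewrite /top !ancestor_parent ?En -?yn.
by apply: spider_parent_inj => //; rewrite -dist_gt0 dist_parent En.
Qed.

Lemma dist_leglen x : x != c -> dist c x <= leglen (top x).
Proof.
move=> xc.
have inj : injective (fun i : 'I_(dist c x) => ancestor c i.+1 x).
  move=> i j E; apply: val_inj => /=; have := congr1 (dist c) E.
  by rewrite !ancestor_dist // => -[].
rewrite -{1}[dist c x]card_ord -(card_imset _ inj); apply: subset_leq_card.
apply/subsetP => y /imsetP[i _ ->]; rewrite inE /top.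
by rewrite ancestor_ancestor.
Qed.

(** Depth maps the leg injectively into the [leglen y] values from 1 to [leglen y], so it is
    onto. *)
Lemma leg_point y i : y \in legs -> 0 < i <= leglen y ->
  exists2 x, top x = y & dist c x = i.
Proof.
move=> yl /andP[i0 il].
pose A := [set (inord (dist c x) : 'I_(leglen y).+1) | x in leg y].
have legc x : x \in leg y -> x != c by rewrite inE -top_legsE => /eqP->.
have hx x : x \in leg y -> dist c x <= leglen y.
  by move=> xl; have := dist_leglen (legc _ xl); move: xl; rewrite inE => /eqP->.
have cA : #|A| = leglen y.
  rewrite card_in_imset // => u v ul vl /(congr1 val) /=.
  rewrite !inordK ?ltnS ?hx // => E; apply: top_dist_inj => //.
  by move: ul vl; rewrite !inE => /eqP-> /eqP->.
have AE : A = [set~ ord0].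
  apply/eqP; rewrite eqEcard cA cardsC1 card_ord leqnn andbT.
  apply/subsetP => u /imsetP[x xl ->]; rewrite !inE -val_eqE /= inordK ?ltnS ?hx //.
  by rewrite -lt0n dist_gt0 legc.
have : inord i \in A by rewrite AE !inE -val_eqE /= inordK //; lia.
case/imsetP => x xl /(congr1 val) /=; rewrite !inordK ?ltnS ?hx // => ->.
by exists x => //; move: xl; rewrite inE => /eqP.
Qed.

Lemma leglen_gt0 y : y \in legs -> 0 < leglen y.
Proof.
move=> yl; apply/card_gt0P; exists y; rewrite inE /top.
by move: yl; rewrite inE => /eqP E; rewrite /ancestor E.
Qed.

Lemma within_leg x y : top x = top y -> dist c x <= dist c y ->
  within e (dist c y - dist c x) x y.
Proof.
move=> txy xy; suff -> : x = ancestor c (dist c x) y by rewrite ancestor_dist // within_ancestor.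
case: (posnP (dist c x)) => [x0|x0].
  by rewrite x0 ancestor0; move/eqP: x0; rewrite dist_eq0 eq_sym => /eqP.
by apply: top_dist_inj; rewrite ?ancestor_dist // txy /top ancestor_ancestor.
Qed.

Lemma sum_leglen : \sum_(y in legs) leglen y = #|T|.-1.
Proof.
rewrite -(cardsC1 c) -sum1_card [RHS](partition_big top (mem legs)) /=; last first.
  move=> x xc. by apply: top_legs; move: xc; rewrite !inE.
apply: eq_bigr => y yl; rewrite /leglen -sum1_card; apply: eq_bigl => x.
rewrite !inE; case: eqP => [E|]; last by rewrite andbF.
by rewrite -top_legsE E yl.
Qed.

Lemma card_legs : #|legs| = deg e c.
Proof. by apply: eq_card => x; rewrite !inE dist_edge. Qed.

(* On each leg [y] the points of the dominating set are at distances
   [s y, s y + k, ...] from the centre, [q y] of them; vertices at distance at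
   most [rho] from the centre are reached through the centre. *)
Lemma spider_gammak k rho (cc : bool) (q s : T -> nat) : rho <= k ->
    cc \/ (exists2 y, y \in legs & 0 < q y /\ s y + rho <= k) ->
    (forall y, y \in legs ->
       q y = 0 /\ leglen y <= rho \/
       [/\ 0 < q y, 0 < s y, s y <= rho + k + 1 &
           s y + (q y).-1 * k <= leglen y <= s y + q y * k]) ->
  gammak e k <= cc + \sum_(y in legs) q y.
Proof.
move=> rk center H.
pose pt y i := odflt c [pick x | (top x == y) && (dist c x == s y + i * k)].
pose D := (if cc then [set c] else set0) :|:
          \bigcup_(y in legs) [set pt y (val i) | i : 'I_(q y)].
apply: (@leq_trans #|D|); last first.
  apply: leq_trans (leq_card_setU _ _) _; apply: leq_add.
    by case: cc {center D}; rewrite ?cards1 ?cards0.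
  elim/big_rec2: _ => [|y m A _ IH]; first by rewrite cards0.
  apply: leq_trans (leq_card_setU _ _) _; apply: leq_add => //.
  by apply: leq_trans (leq_imset_card _ _) _; rewrite cardE size_enum_ord.
have ptP y i : y \in legs -> i < q y -> exists2 x, x \in D & top x = y /\ dist c x = s y + i * k.
  move=> yl iq; exists (pt y i).
    apply/setUP; right; apply/bigcupP; exists y => //.
    by apply/imsetP; exists (Ordinal iq).
  rewrite /pt; case: pickP => [x /andP[/eqP-> /eqP->]//|none].
  case: (H y yl) => [[q0]|[q0 s0 _ /andP[l1 l2]]]; first by lia.
  have ik : i * k <= (q y).-1 * k by rewrite leq_mul2r; lia.
  have [|x xt xd] := @leg_point y (s y + i * k) yl; first by lia.
  by have := none x; rewrite xt xd !eqxx.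
have [d dD dc] : exists2 d, d \in D & within e (k - rho) d c.
  case: center => [ct|[y yl [q0 sk]]].
    exists c; last exact: within_refl.
    by rewrite /D ct !inE eqxx.
  have [x xD [_ xd]] := ptP y 0 yl q0; exists x => //.
  by apply: within_sym; rewrite -dist_le xd; lia.
apply/gammak_le/kdomP => v.
have [hr|hr] := leqP (dist c v) rho.
  exists d => //; apply: (@within_mono (k - rho + dist c v)); first by lia.
  by apply: within_trans dc (within_dist _ _).
have vc : v != c by rewrite -dist_gt0; lia.
have vl := dist_leglen vc; have yl := top_legs vc.
case: (H _ yl) => [[]|[q0 s0 sr /andP[l1 l2]]]; first by lia.
set y := top v in yl vl q0 s0 sr l1 l2.
(* The first point serves vertices up to [s y], the last one those beyond it, and in between
   division by [k] finds the nearest point on the side of the centre. *)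
have [i iq i1] : exists2 i, i < q y &
    (s y + i * k <= dist c v + k) && (dist c v <= s y + i * k + k).
  have [hs|hs] := leqP (dist c v) (s y); first by exists 0 => //; lia.
  have [qe|qe] := leqP (s y + (q y).-1 * k) (dist c v).
    exists (q y).-1; first by lia.
    have : q y * k = (q y).-1 * k + k by rewrite -mulSnr prednK.
    by lia.
  have k0 : 0 < k by case: (k) qe => //; lia.
  exists ((dist c v - s y) %/ k).
    rewrite -(ltn_pmul2r k0); have := leq_divM (dist c v - s y) k.
    have : (q y).-1 * k <= q y * k by rewrite leq_mul2r leq_pred orbT.
    by lia.
  by have := divn_eq (dist c v - s y) k; have := ltn_pmod (dist c v - s y) k0; lia.
have [x xD [xt xd]] := ptP y i yl iq; exists x => //.
case: (leqP (dist c x) (dist c v)) => xv.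
  by apply: within_mono (within_leg xt xv); lia.
by apply: within_sym; apply: within_mono (within_leg (esym xt) (ltnW xv)); lia.
Qed.

(** Summing the lengths [q k + r + 1] gives [Q k + R + 1 = k g] for the totals [Q] and [R]. Together
    with [g <= 1 + Q] this forces [Q = g - 1] and [R = k - 1]; any other shape of the legs would
    give [g <= Q]. *)
Lemma spider_legs k : 1 < k -> 2 < gammak e k ->
    #|T| = k * gammak e k + #|legs| ->
  exists2 z, z \in legs & leglen z = k /\
    (forall y, y \in legs -> y != z -> leglen y = 1 \/ leglen y = k.+1).
Proof.
move=> k1 g2 Tcard; set g := gammak e k in g2 Tcard *.
have k0 : 0 < k by lia.
pose q y := (leglen y).-1 %/ k; pose r y := (leglen y).-1 %% k.
have lenE y : y \in legs -> leglen y = q y * k + r y + 1.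
  by move=> /leglen_gt0 y0; rewrite -divn_eq; lia.
have rk y : r y < k by apply: ltn_pmod.
have sumE : (\sum_(y in legs) q y) * k + \sum_(y in legs) r y + 1 = k * g.
  have := sum_leglen; rewrite Tcard (eq_bigr _ lenE) !big_split /=.
  by rewrite -big_distrl sum1_card /=; nia.
set Q := \sum_(y in legs) q y in sumE; set R := \sum_(y in legs) r y in sumE.
(* The centre and the points at distances [k], [2 k], ..., [q k] on each leg dominate, because
   [r < k] leaves at most [k] vertices past the last point. *)
have gQ : g <= 1 + Q.
  apply: (@spider_gammak k k true q (fun=> k)) => //; first by left.
  move=> y yl; rewrite (lenE y yl); have := rk y.
  case: (posnP (q y)) => [->|q0] ryk; [left|right]; first by lia.
  have : q y * k = (q y).-1 * k + k by rewrite -mulSnr prednK.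
  by split; lia.
have QE : Q = g.-1 by nia.
have RE : R = k.-1 by nia.
have q1 y : y \in legs -> q y <= 1.
  move=> yl; rewrite leqNgt; apply/negP => qy2.
  pose q' x := if x == y then (q y).-1 else q x.
  have : Q = (\sum_(x in legs) q' x).+1.
    rewrite /Q (bigD1 y) //= [in RHS](bigD1 y) //= /q' eqxx -addSn prednK; last by lia.
    by congr (_ + _); apply: eq_bigr => x /andP[_ /negPf->].
  suff : g <= true + \sum_(x in legs) q' x by lia.
  (* The centre covers the first [k] vertices of leg [y], so its first point can move out to
     [2 k + 1], and [q y - 1] points still reach the end. *)
  apply: (@spider_gammak k k true q' (fun x => if x == y then k.*2.+1 else k)) => //.
    by left.
  move=> x xl; rewrite (lenE x xl) /q'; have := rk x; case: eqP => [->|_] rxk.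
    right.
    have : q y * k = (q y).-1 * k + k by rewrite -mulSnr prednK; lia.
    have : (q y).-1 * k = (q y).-2 * k + k by rewrite -mulSnr prednK; lia.
    by split; lia.
  case: (posnP (q x)) => [->|q0]; [left|right]; first by lia.
  have : q x * k = (q x).-1 * k + k by rewrite -mulSnr prednK.
  by split; lia.
have sum3 (a b d : T) : a \in legs -> b \in legs -> d \in legs ->
    a != b -> d != a -> d != b -> r a + r b + r d <= k.-1.
  move=> al bl dl ab da db.
  rewrite -RE /R (bigD1 a) //= (bigD1 b) ?bl 1?eq_sym //= (bigD1 d) ?dl ?da //=; lia.
have sum2 (a b : T) : a \in legs -> b \in legs -> a != b -> r a + r b <= k.-1.
  move=> al bl ab; rewrite -RE /R (bigD1 a) //= (bigD1 b) ?bl 1?eq_sym //=; lia.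
have [y0 y0l y0q] : exists2 y, y \in legs & q y == 1.
  apply/exists_inP; apply: contraT; rewrite negb_exists_in => /forall_inP H.
  suff : Q = 0 by lia.
  by rewrite /Q big1 // => y yl; have := H y yl; have := q1 y yl; lia.
(* The smallest remainder puts the first point of [y1], at distance [r y1 + 1], as close to the
   centre as possible, so that it can replace the centre. *)
pose y1 := [arg min_(y < y0 | (y \in legs) && (q y == 1)) r y].
have [y1l y1q y1min] : [/\ y1 \in legs, q y1 = 1 &
    forall y, y \in legs -> q y = 1 -> r y1 <= r y].
  rewrite /y1; case: arg_minnP => [|y /andP[yl /eqP yq] ym]; first by rewrite y0l.
  by split=> // z zl zq; apply: ym; rewrite zl zq.
have [y2 [y2l y2q y12]] : exists y, [/\ y \in legs, q y = 1 & y1 != y].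
  suff /exists_inP[y /andP[yl yn] /eqP yq] : [exists (y | (y \in legs) && (y != y1)), q y == 1].
    by exists y; rewrite yl yq eq_sym yn.
  apply: contraT; rewrite negb_exists_in => /forall_inP H.
  suff : Q = 1 by lia.
  rewrite /Q (bigD1 y1) //= y1q big1 // => y /[dup] /andP[yl _] /H.
  by have := q1 y yl; lia.
have r12 := y1min _ y2l y2q.
have [/exists_inP[z zl /andP[/eqP zq /eqP zr]]|none] :=
    boolP [exists z in legs, (q z == 0) && (r z == k.-1)].
  exists z => //; split; first by rewrite lenE // zq zr; lia.
  move=> y yl yz; rewrite lenE //; have := sum2 _ _ yl zl yz; rewrite zr.
  by have := q1 y yl; case: (q y) => [|[|n]] //; lia.
exfalso; suff : g <= false + Q by lia.
(* On a leg with [q = 1] the point at [r + 1] is exactly [k] from the end. The point of [y1] reaches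
   [k - 1 - r y1] beyond the centre, which is [rho]. *)
apply: (@spider_gammak k (k.-1 - r y1) false q (fun y => (r y).+1)); first by lia.
  by right; exists y1 => //; rewrite y1q; have := sum2 _ _ y1l y2l y12; lia.
move=> y yl; rewrite (lenE y yl); have := q1 y yl; have := rk y.
case E : (q y) => [|[|n]] // ryk _; last by right; split; lia.
left; split=> //.
(* The goal is [r y + r y1 + 2 <= k]. It follows from [sum3] if [r y2 > 0]; if [r y2 = 0] then also
   [r y1 = 0], and [r y != k - 1] suffices. *)
have rz : r y != k.-1.
  by apply: contraNneq none => ry; apply/exists_inP; exists y; rewrite ?E ?ry ?eqxx.
have yy1 : y != y1 by apply/eqP => yE; move: y1q; rewrite -yE E.
have yy2 : y != y2 by apply/eqP => yE; move: y2q; rewrite -yE E.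
have := sum3 _ _ _ y1l y2l yl y12 yy1 yy2; lia.
Qed.

(* Vertices of the [Tnks_edge] blocks [j(k+1), ..., j(k+1)+k] are numbered along
   the legs of length [k.+1]; block [0] is [c] followed by the leg [z] of length [k]. *)
Lemma spider_isomorphic k g z : 0 < k -> #|T| = k * g + #|legs| ->
    z \in legs -> leglen z = k ->
    (forall y, y \in legs -> y != z -> leglen y = 1 \/ leglen y = k.+1) ->
  isomorphic T e #|T| (Tnks_edge #|T| k g).
Proof.
move=> k0 Tcard zl zk len.
pose A := legs :\ z; pose B := [set y | leglen y == k.+1].
have legsA : #|legs| = #|A|.+1 by rewrite (cardsD1 z) zl.
have cA : #|A| = #|A :&: B| + #|A :\: B| by rewrite cardsID.
(* Counting vertices leg by leg shows that exactly [g - 1] legs have length [k + 1]. *)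
have gL : g = #|A :&: B|.+1.
  have := sum_leglen; rewrite (bigD1 z) //= zk Tcard legsA cA.
  rewrite (eq_bigl (mem A)); last by move=> y; rewrite !inE andbC.
  rewrite (big_setID B) /= (eq_bigr (fun=> k.+1)); last first.
    by move=> y; rewrite !inE => /andP[_ /eqP].
  rewrite [X in _ + (_ + X) = _](eq_bigr (fun=> 1)); last first.
    move=> y; rewrite !inE => /and3P[yk yz yl]; have := len y; rewrite inE yl => /(_ isT yz).
    by case=> // yk'; rewrite yk' eqxx in yk.
  by rewrite !sum_nat_const; nia.
pose bl := z :: enum (A :&: B); pose sh := enum (A :\: B).
have blsize : size bl = g by rewrite /= -cardE gL.
have shsize : size sh = #|A :\: B| by rewrite -cardE.
have inbl y : y \in bl -> index y bl < g by rewrite -blsize index_mem.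
have blsh y : y \in legs -> y \notin bl -> y \in sh /\ leglen y = 1.
  move=> yl; rewrite inE negb_or !mem_enum !inE => /andP[yz].
  have := yl; rewrite inE yz => -> /= yk; rewrite yk; split=> //.
  by case: (len y yl yz) => // yk'; rewrite yk' eqxx in yk.
have blk y : y \in bl -> leglen y = k + (y != z).
  rewrite inE; case: eqP => [->|_] /=; first by rewrite zk addn0.
  by rewrite mem_enum !inE addn1 => /andP[_ /eqP].
have idx0 y : y \in bl -> (0 < index y bl) = (y != z).
  by move=> yb /=; rewrite eq_sym; case: eqP.
(* In block 0 the centre occupies position 0, so positions on [z] equal depths; in the other blocks
   the leg starts at position 0, hence the shift by [top x != z]. *)
pose F x := if x == c then 0 else
  if top x \in bl then index (top x) bl * k.+1 + (dist c x - (top x != z))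
  else k.+1 * g + index (top x) sh.
have rem x : x != c -> top x \in bl ->
    [/\ 0 < dist c x, dist c x - (top x != z) < k.+1,
        index (top x) bl * k.+1 + k < k.+1 * g &
        (top x != z) -> k < index (top x) bl * k.+1].
  move=> xc xb; have := dist_leglen xc; rewrite (blk _ xb) -dist_gt0 in xc * => xd.
  split=> //; first by lia.
    by have := inbl _ xb; move: (index _ _) => i; nia.
  by rewrite -(idx0 _ xb); move: (index _ _) => i; nia.
have shd x : x != c -> top x \notin bl -> dist c x = 1 /\ top x \in sh.
  move=> xc xb; have [xs x1] := blsh _ (top_legs xc) xb; split=> //.
  by have := dist_leglen xc; rewrite x1; rewrite -dist_gt0 in xc; lia.
have F0 x : (0 < F x) = (x != c).
  rewrite /F; case: eqVneq => // xc; case: ifP => xb; last by rewrite gL; lia.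
  have [h1 h2 h3] := rem _ xc xb; case: eqP => /= _; first by lia.
  by move/(_ isT); lia.
have Flt x : F x < #|T|.
  rewrite Tcard legsA cA /F; case: eqVneq => [_|xc]; first by lia.
  case: ifP => xb; first by have [] := rem _ xc xb; lia.
  have [_] := shd x xc (negbT xb); rewrite -index_mem shsize; nia.
have Finj : injective F.
  move=> x y Fxy; have := F0 x; rewrite Fxy F0.
  have [-> /esym/negbFE/eqP->//|yc /esym xc] := eqVneq y c.
  move: Fxy; rewrite /F (negPf xc) (negPf yc).
  case: ifP => xb; case: ifP => yb E.
  - have [x1 x2 _ _] := rem x xc xb; have [y1 y2 _ _] := rem y yc yb.
    have txy : top x = top y.
      apply: (@index_inj _ z bl) => //; have := congr1 (divn^~ k.+1) E.
      by rewrite !divnMDl // !divn_small // !addn0.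
    apply: top_dist_inj => //; move: E; rewrite txy => /addnI; lia.
  - by have [] := rem x xc xb; lia.
  - by have [] := rem y yc yb; lia.
  have [x1 xs] := shd x xc (negbT xb); have [y1 ys] := shd y yc (negbT yb).
  apply: top_dist_inj; last by rewrite x1 y1.
  by apply: (@index_inj _ z sh) => //; apply: addnI E.
have Fpar x : x != c -> F (parent c x) = tparent k g (F x).
  move=> xc; have := F0 x; rewrite xc /F (negPf xc) /tparent => Fx.
  have pc1 : dist c x = 1 -> parent c x = c.
    by move=> x1; apply/eqP; rewrite eq_sym -dist_eq0 dist_parent x1.
  case: ifP Fx => xb Fx; last first.
    by rewrite pc1 ?eqxx ?ltnNge ?leq_addr //; have [] := shd x xc (negbT xb).
  have [h1 h2 h3 h4] := rem _ xc xb.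
  have -> : index (top x) bl * k.+1 + (dist c x - (top x != z)) < k.+1 * g by lia.
  have [pc|pc] := eqVneq (parent c x) c.
    have d1 : dist c x = 1 by move/eqP: pc; rewrite eq_sym -dist_eq0 dist_parent; lia.
    rewrite modnMDl modn_small // d1; case: (eqVneq (top x) z) => [tz|_] //=.
    by rewrite tz eqxx.
  rewrite -dist_gt0 dist_parent in pc.
  rewrite /top ancestor_parent; last by lia.
  rewrite -/(top x) xb dist_parent modnMDl modn_small //.
  by case: (top x != z) => /=; rewrite gtn_eqF; lia.
exists (fun x => Ordinal (Flt x)); split.
  apply: inj_card_bij; last by rewrite card_ord.
  by move=> x y /(congr1 val) /= /Finj.
move=> x y; rewrite (edgeE c) /Tnks_edge /= !F0.
by congr (_ || _); apply: andb_id2l => /Fpar <-; rewrite (inj_eq Finj) eq_sym.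
Qed.

End Spider.
End Graph.

(** * Degrees in the starlike tree *)

Section Tnks.
Variables (T : finType) (e : rel T) (n k g : nat).

Lemma deg_le_size (phi : T -> nat) u s : injective phi ->
  (forall v, e u v -> phi v \in s) -> deg e u <= size s.
Proof.
move=> inj H; rewrite /deg cardE -(size_map phi); apply: uniq_leq_size.
  by rewrite map_inj_uniq ?enum_uniq.
by move=> _ /mapP[v + ->]; rewrite mem_enum inE; apply: H.
Qed.

(** This is the converse for equality: a positive label has only its [tparent] and its successor as
    possible neighbours, so only the centre can have degree above 2, and the last vertex of each
    block and the pendent vertices are leaves. *)
Lemma Tnks_degrees : 0 < k -> 0 < g -> isomorphic T e n (Tnks_edge n k g) ->
  #|inner e| <= k * g /\ #|[set u | 2 < deg e u]| <= 1.
Proof.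
move=> k0 g0 [f [/bij_inj f_inj fE]].
pose phi u := val (f u).
have phi_inj : injective phi by move=> x y /val_inj/f_inj.
have nbr u v : 0 < phi u -> e u v -> phi v = tparent k g (phi u) \/
    [/\ phi v = (phi u).+1, phi v < k.+1 * g & phi v %% k.+1 != 0].
  rewrite fE /Tnks_edge -!/(phi _) => u0 /orP[/andP[_ /eqP]|/andP[v0 /eqP]]; first by left.
  rewrite /tparent; case: ifP => [vg|_]; last by lia.
  case: eqP => [_|/eqP vk]; first by lia.
  by right; split=> //; lia.
clearbody phi.
have deg2 u : 0 < phi u -> deg e u <= 2.
  move=> u0; apply: (@deg_le_size phi _ [:: tparent k g (phi u); (phi u).+1]) => // v.
  by rewrite !inE => /(nbr _ _ u0)[|[]] ->; rewrite eqxx ?orbT.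
split; last first.
  apply/card_le1_eqP => u v; rewrite !inE => ud vd; apply: phi_inj.
  have := deg2 u; have := deg2 v; lia.
have deg1 u : 1 < deg e u -> phi u < k.+1 * g /\ phi u %% k.+1 < k.
  move=> ud; have H : 0 < phi u -> exists2 v, e u v & phi v != tparent k g (phi u).
    move=> u0; suff /existsP[v /andP[]] : [exists v, e u v && (phi v != tparent k g (phi u))].
      by exists v.
    apply: contraLR ud; rewrite negb_exists -leqNgt => /forallP uv.
    apply: (@deg_le_size phi _ [:: tparent k g (phi u)]) => // v ev.
    by have := uv v; rewrite ev negbK inE.
  case: (posnP (phi u)) => [->|u0]; first by rewrite mod0n muln_gt0 g0.
  have [v ev /eqP vp] := H u0.
  case: (nbr _ _ u0 ev) => // -[-> vg vk]; split; first by apply: ltnW.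
  have := ltn_pmod (phi u) (ltn0Sn k); rewrite ltnS leq_eqVlt => /orP[/eqP uk|//].
  by rewrite -addn1 -modnDml uk addn1 modnn in vk.
(* Dropping the last position of each block and renumbering sends the inner vertices injectively
   into the [k * g] numbers below [k * g]. *)
pose psi u := phi u %/ k.+1 * k + phi u %% k.+1.
rewrite cardE -(size_map psi) -[k * g](size_iota 0); apply: uniq_leq_size.
  rewrite map_inj_in_uniq ?enum_uniq // => u v.
  rewrite !mem_enum !inE => /deg1[_ uk] /deg1[_ vk]; rewrite /psi => E; apply: phi_inj.
  have Ed := congr1 (divn^~ k) E; have Em := congr1 (modn^~ k) E.
  rewrite /= in Ed Em; rewrite !divnMDl // in Ed.
  rewrite !(divn_small uk) !(divn_small vk) !addn0 in Ed.
  rewrite !modnMDl !(modn_small uk) !(modn_small vk) in Em.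
  by rewrite [LHS](divn_eq _ k.+1) Ed Em -divn_eq.
move=> _ /mapP[u + ->]; rewrite mem_enum inE mem_iota => /deg1[ug uk] /=.
have : phi u %/ k.+1 < g by rewrite ltn_divLR // mulnC.
by rewrite /psi; move: (_ %/ _) (_ %% _) uk => a b; nia.
Qed.

End Tnks.

(** * Both bounds and their common equality case *)

Theorem theorem3p5 (T : finType) (e : rel T) (k : nat) :
  2 <= k -> is_tree e -> 3 <= gammak e k ->
  let n := #|T| in
  let g := gammak e k in
  [/\ 4 ^ (k * g - 1) * (n - k * g) ^ 2 <= Pi1 e,
      Pi2 e <= 4 ^ (k * g - 1) * (n - k * g) ^ (n - k * g),
      Pi1 e = 4 ^ (k * g - 1) * (n - k * g) ^ 2 <->
        isomorphic T e n (Tnks_edge n k g) &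
      Pi2 e = 4 ^ (k * g - 1) * (n - k * g) ^ (n - k * g) <->
        isomorphic T e n (Tnks_edge n k g)].
Proof.
move=> k2 [[e_sym e_irr] e_conn e_card] g3 n g.
have k0 : 0 < k by lia.
have T1 : 1 < #|T|.
  have : gammak e k <= #|[set: T]|; last by rewrite cardsT; lia.
  by apply: gammak_le; apply/forallP => v; rewrite inE.
have gI : k * g <= #|inner e|.
  by apply: gammak_inner => //; rewrite /g; lia.
have M0 : 0 < k * g by rewrite /g muln_gt0; lia.
pose tight := (#|inner e| <= k * g) && (#|[set u | 2 < deg e u]| <= 1).
have tightP : tight <-> isomorphic T e n (Tnks_edge n k g).
  split; last first.
    by case/Tnks_degrees => // [|h1 h2]; [rewrite /g; lia | rewrite /tight h1].
  case/andP=> Ig d2.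
  have IE : #|inner e| = k * g by lia.
  (* If no degree exceeds 2, any inner vertex can serve as the centre. *)
  have [c cI cdeg] : exists2 c, c \in inner e & forall x, x != c -> deg e x <= 2.
    have [Z|[c cd]] := set_0Vmem [set u | 2 < deg e u].
      have /card_gt0P[c cI] : 0 < #|inner e| by lia.
      exists c => // x _; rewrite leqNgt; apply/negP => xd.
      by have := in_set0 x; rewrite -Z inE xd.
    exists c; first by move: cd; rewrite !inE; lia.
    move=> x; rewrite leqNgt; apply: contraNN => xd; apply/eqP.
    by apply: (card_le1_eqP d2) => //; rewrite inE.
  (* The degree sum reads [deg c + 2 (k g - 1) + (n - k g) = 2 (n - 1)], so [c] has [n - k g]
     legs. *)
  have Tcard : #|T| = k * g + #|legs e_conn c|.
    rewrite (card_legs e_sym e_conn e_card); have := sum_deg e_card; rewrite (bigD1 c) //=.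
    rewrite (bigID (mem (inner e))) /=.
    rewrite (eq_bigr (fun=> 2)); last first.
      by move=> x /andP[/cdeg xd]; rewrite inE; lia.
    rewrite [X in _ + (_ + X) = _](eq_bigr (fun=> 1)); last first.
      by move=> x /andP[_]; rewrite inE; have := deg_gt0 e_sym e_conn e_card x T1; lia.
    rewrite !sum_nat_cond_const.
    have TE : #|T| = k * g + #|~: inner e| by rewrite -IE cardsC.
    have := cardsD1 c (inner e); rewrite cI IE TE add1n => ->.
    rewrite (_ : #|[set i | _ & i \in _]| = #|inner e :\ c|); last first.
      by apply: eq_card => x; rewrite !inE.
    rewrite (_ : #|[set i | _ & _]| = #|~: inner e|); last first.
      by apply: eq_card => x; rewrite !inE; case: eqP => // ->; move: cI; rewrite inE => ->.
    by lia.
  have [z zl [zk len]] := spider_legs e_sym e_card cdeg k2 g3 Tcard.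
  exact: (spider_isomorphic e_sym e_card cdeg k0 Tcard zl zk len).
have P1 : if tight then Pi1 e = 4 ^ (k * g - 1) * (n - k * g) ^ 2
          else 4 ^ (k * g - 1) * (n - k * g) ^ 2 < Pi1 e.
  rewrite subn1; apply: (@prod_deg_extremal _ _ e_sym e_conn e_card
    ltn (fun d => d ^ 2) (k * g)) => //.
  - exact: ltn_trans.
  - by move=> c a b c0; rewrite /= ltn_pmul2l.
  - by move=> a a0; rewrite expn_gt0 a0.
  - by move=> a b a2 b2; rewrite /= -!expnMn ltn_exp2r //; nia.
  - by move=> a a2; rewrite /= -!expnMn ltn_exp2r //; lia.
have P2 : if tight then Pi2 e = 4 ^ (k * g - 1) * (n - k * g) ^ (n - k * g)
          else Pi2 e < 4 ^ (k * g - 1) * (n - k * g) ^ (n - k * g).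
  rewrite subn1.
  apply: (@prod_deg_extremal _ _ e_sym e_conn e_card
    (fun a b => b < a) (fun d => d ^ d) (k * g)) => //.
  - by move=> a b c /= h1 h2; apply: ltn_trans h2 h1.
  - by move=> c a b c0; rewrite /= ltn_pmul2l.
  - by move=> a a0; rewrite expn_gt0 a0.
  - exact: selfpow_merge.
  - exact: selfpow_pred.
split.
- by move: P1; case: ifP => [_ ->|_ /ltnW].
- by move: P2; case: ifP => [_ ->|_ /ltnW].
- rewrite -tightP; move: P1; case: ifP => //= _ h; split=> // E.
  by rewrite E ltnn in h.
- rewrite -tightP; move: P2; case: ifP => //= _ h; split=> // E.
  by rewrite E ltnn in h.
Qed.
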